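(* Let $m\ge 2$ be an integer and let $H$ be a finite, simple, connected graph of order at least $2$. The Cartesian product $K_m \,\square\, H$ is well-dominated if and only if either $m \neq 3$ and $H$ is isomorphic to $K_m$, or $m=3$ and $H$ is isomorphic to $K_3$ or to the path $P_3$ on three vertices.
   Context: A set $D$ of vertices of a graph is dominating if every vertex is in $D$ or adjacent to a vertex of $D$. A graph is well-dominated if every minimal (with respect to inclusion) dominating set is a minimum dominating set. The Cartesian product $G\,\square\, H$ has vertex set $V(G)\times V(H)$, with $(g_1,h_1)$ adjacent to $(g_2,h_2)$ iff either ($g_1=g_2$ and $h_1h_2\in E(H)$) or ($h_1=h_2$ and $g_1g_2\in E(G)$). *)

(* Defs.v *)
From mathcomp Require Import all_boot.
Set Implicit Arguments. Unset Strict Implicit. Unset Printing Implicit Defensive.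

Definition simple_graph (V : finType) (e : rel V) : Prop :=
  symmetric e /\ irreflexive e.

Definition connected_graph (V : finType) (e : rel V) : Prop :=
  forall x y : V, connect e x y.

Definition dominating (V : finType) (e : rel V) (D : {set V}) : Prop :=
  forall v : V, v \in D \/ exists2 u, u \in D & e u v.

Definition minimal_dominating (V : finType) (e : rel V) (D : {set V}) : Prop :=
  dominating e D /\ forall D' : {set V}, D' \proper D -> ~ dominating e D'.

Definition minimum_dominating (V : finType) (e : rel V) (D : {set V}) : Prop :=
  dominating e D /\ forall D' : {set V}, dominating e D' -> #|D| <= #|D'|.

Definition well_dominated (V : finType) (e : rel V) : Prop :=
  forall D : {set V}, minimal_dominating e D -> minimum_dominating e D.

Definition cartesian_product (VG VH : finType) (eG : rel VG) (eH : rel VH)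
  : rel (VG * VH) :=
  fun x y => ((x.1 == y.1) && eH x.2 y.2) || ((x.2 == y.2) && eG x.1 y.1).

Definition complete_graph (m : nat) : rel 'I_m := fun i j => i != j.

Definition path3 : rel 'I_3 := fun i j => (i.+1 == j :> nat) || (j.+1 == i :> nat).

Definition graph_iso (V1 V2 : finType) (e1 : rel V1) (e2 : rel V2) : Prop :=
  exists f : V1 -> V2, bijective f /\ forall x y, e2 (f x) (f y) = e1 x y.
Arguments complete_graph m : clear implicits.

(* Main.v *)
Require Import Defs.
From mathcomp Require Import all_boot.
From mathcomp Require Import zify.

Set Implicit Arguments.
Unset Strict Implicit.
Unset Printing Implicit Defensive.

(** A single row, that is a copy of [H], dominates the product, and each of its
    vertices is needed. So, when the product is well-dominated, every dominating
    set has at least [#|V(H)|] elements, and at most [#|V(H)|] of them cannot be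
    spared. Both bounds are applied to sets with one row [B] and all other rows
    [A], where [A] and [B] are sets of vertices of [H]. With [A] a vertex or an
    edge they show that the closed neighbourhoods in [H] have [m - 1] or [m]
    elements, and that those of the two ends of an edge are comparable, or else
    have [m] elements and only the two ends in common. If they all have [m]
    elements, [H] is complete. If [N[v]] has [m - 1] elements and [h] is a
    neighbour of [v], then [N[h]] is [N[v]] plus one vertex [w], and [B] made of
    [v], [w] and the complement of [N[h]], with [A = {h}], leaves only the path
    [v h w] and [m = 3].

    Conversely, in the listed products every dominating set contains a
    dominating set with [m] elements: one in each column (copy of [K_m]) if it
    meets all columns, and one in each row otherwise. *)

Lemma exists_neq (T : finType) (x : T) : 1 < #|T| -> exists y, y != x.
Proof.
move=> T_gt1; suff /set0Pn[y] : [set~ x] != set0 by rewrite !inE; exists y.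
by rewrite -card_gt0 cardsC1; lia.
Qed.

Lemma setUUC (T : finType) (A B : {set T}) : A :|: ~: B :|: B = setT.
Proof. by rewrite -setUA [~: B :|: B]setUC setUCr setUT. Qed.

Lemma cardsUC (T : finType) (A B : {set T}) :
  A \subset B -> #|A :|: ~: B| = #|A| + #|~: B|.
Proof.
by move=> sAB; apply/eqP; rewrite leq_card_setU disjoints_subset setCK.
Qed.

Lemma cover_distinct_representatives (T : finType) (A B : {set T}) :
    1 < #|T| -> A :|: B = setT -> A != set0 -> B != set0 ->
  exists2 a, a \in A & exists2 b, b \in B & a != b.
Proof.
move=> T_gt1 ABT /set0Pn[a aA] /set0Pn[b bB].
have [ab|] := eqVneq a b; last by exists a => //; exists b.
have [c ca] := exists_neq a T_gt1.
have /setUP[cA|cB] : c \in A :|: B by rewrite ABT inE.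
  by exists c => //; exists b; rewrite // -ab.
by exists a => //; exists c; rewrite // eq_sym.
Qed.

Section Domination.

Variables (V : finType) (e : rel V).
Implicit Types (A D S T E : {set V}) (v x y : V).

Definition closed_nbhd v : {set V} := [set u | (u == v) || e v u].

Definition dominated A : {set V} := \bigcup_(a in A) closed_nbhd a.

(* The external private neighbourhood epn(a, A) of domination theory. *)
Definition ext_private A a : {set V} :=
  dominated A :\: (A :|: dominated (A :\ a)).

Lemma closed_nbhd_refl v : v \in closed_nbhd v.
Proof. by rewrite inE eqxx. Qed.

Lemma edge_closed_nbhd v u : e v u -> u \in closed_nbhd v.
Proof. by rewrite inE orbC => ->. Qed.

Lemma dominatedP A v :
  reflect (exists2 a, a \in A & v \in closed_nbhd a) (v \in dominated A).
Proof. exact: bigcupP. Qed.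

Lemma dominated0 : dominated set0 = set0.
Proof. exact: big_set0. Qed.

Lemma dominated1 v : dominated [set v] = closed_nbhd v.
Proof. exact: big_set1. Qed.

Lemma dominatedU A S : dominated (A :|: S) = dominated A :|: dominated S.
Proof. exact: bigcup_setU. Qed.

Lemma sub_dominated A : A \subset dominated A.
Proof.
by apply/subsetP => a aA; apply/dominatedP; exists a; rewrite ?closed_nbhd_refl.
Qed.

Lemma dominatedS A S : A \subset S -> dominated A \subset dominated S.
Proof. by move/setUidPr <-; rewrite dominatedU subsetUl. Qed.

Definition completion A : {set V} := A :|: ~: dominated A.

Lemma completionU_dominated A : completion A :|: dominated A = setT.
Proof. exact: setUUC. Qed.

Lemma dominated_completion A : dominated (completion A) = setT.
Proof.
apply/eqP; rewrite -subTset -(completionU_dominated A) subUset sub_dominated.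
by rewrite dominatedS ?subsetUl.
Qed.

Lemma card_completion A : #|completion A| = #|A| + #|~: dominated A|.
Proof. exact/cardsUC/sub_dominated. Qed.

Lemma ext_private_notin_completion A a p : p \in ext_private A a ->
  p \notin A :|: completion A :|: dominated (A :\ a).
Proof.
case/setDP=> pNA; rewrite !in_setU => /norP[/negPf-> /negPf->].
by rewrite orbF in_setC pNA.
Qed.

Lemma dominatingE D : dominating e D <-> dominated D = setT.
Proof.
split=> [domD|domD v].
  apply/setP => v; rewrite inE; apply/dominatedP.
  case: (domD v) => [vD|[u uD uv]]; [exists v | exists u] => //.
    exact: closed_nbhd_refl.
  exact: edge_closed_nbhd.
have /dominatedP[u uD] : v \in dominated D by rewrite domD inE.
by rewrite inE => /orP[/eqP->|uv]; [left | right; exists u].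
Qed.

Lemma dominatingS D S : D \subset S -> dominating e D -> dominating e S.
Proof.
move=> sDS /dominatingE domD; apply/dominatingE/eqP.
by rewrite -subTset -domD dominatedS.
Qed.

Lemma minimal_dominating_exists S : dominating e S ->
  exists2 D : {set V}, D \subset S & minimal_dominating e D.
Proof.
move=> /dominatingE/eqP domS.
have [D /minsetP[/eqP domD minD] sDS] :=
  @minset_exists _ (fun D => dominated D == setT) _ domS.
exists D => //; split; first exact/dominatingE.
move=> D' ltD'D /dominatingE/eqP domD'.
by have := ltD'D; rewrite (minD _ domD' (proper_sub ltD'D)) properxx.
Qed.

(* A minimal dominating subset of S keeps every element of E. *)
Lemma well_dominated_card S T E :
    well_dominated e -> dominating e S -> dominating e T -> E \subset S ->
    {in E, forall x, ~ dominating e (S :\ x)} ->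
  #|E| <= #|T|.
Proof.
move=> wd domS domT sES critE.
have [D sDS mD] := minimal_dominating_exists domS.
apply: leq_trans ((wd D mD).2 T domT).
apply/subset_leq_card/subsetP => x xE; apply: contraT => xD.
by case: (critE x xE); apply: dominatingS mD.1; rewrite subsetD1 sDS.
Qed.

Definition has_dominating_subset D k : Prop :=
  exists D' : {set V}, [/\ D' \subset D, dominating e D' & #|D'| = k].

Lemma well_dominated_const k :
    (forall D, dominating e D -> has_dominating_subset D k) ->
  well_dominated e.
Proof.
move=> subk D [domD minD]; split=> // T /subk[T' [sT'T _ cT']].
have [D' [sD'D domD' cD']] := subk D domD.
suff eqD : D' = D by rewrite -eqD cD' -cT' subset_leq_card.
by apply/eqP; rewrite eqEproper sD'D; apply/negP => /minD; apply.
Qed.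

End Domination.

Section SimpleGraph.

Variables (V : finType) (e : rel V).
Hypotheses (sym_e : symmetric e) (irr_e : irreflexive e).

Local Notation "N[ v ]" := (closed_nbhd e v) (format "N[ v ]").

Lemma closed_nbhd_sym x y : (x \in N[y]) = (y \in N[x]).
Proof. by rewrite !inE eq_sym sym_e. Qed.

Lemma edgeE x y : e x y = (x != y) && (y \in N[x]).
Proof. by rewrite inE eq_sym; case: eqVneq => [->|_] //=; rewrite irr_e. Qed.

Lemma edge_neq x y : e x y -> x != y.
Proof. by rewrite edgeE => /andP[]. Qed.

Lemma edge_sub_closed_nbhdI x y : e x y -> [set x; y] \subset N[x] :&: N[y].
Proof.
move=> xy; rewrite subUset !sub1set !in_setI !closed_nbhd_refl.
by rewrite closed_nbhd_sym edge_closed_nbhd.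
Qed.

Lemma ext_private1 v x : e v x -> x \in ext_private e [set v] v.
Proof.
move=> vx; rewrite in_setD in_setU setDv dominated0 dominated1 in_set1 in_set0.
by rewrite eq_sym orbF edge_neq ?edge_closed_nbhd.
Qed.

Lemma ext_private2l x y p :
  e x y -> p \in N[x] -> p \notin N[y] -> p \in ext_private e [set x; y] x.
Proof.
move=> xy px py; apply/setDP; split.
  by rewrite dominatedU !dominated1 inE px.
have px_neq : p != x.
  by apply: contraNneq py => ->; rewrite closed_nbhd_sym edge_closed_nbhd.
have py_neq : p != y by apply: contraNneq py => ->; apply: closed_nbhd_refl.
have sub1 : [set x; y] :\ x \subset [set y].
  by apply/subsetP => z; rewrite !inE; case: eqVneq.
rewrite in_setU in_set2 (negPf px_neq) (negPf py_neq) /=.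
by apply: contra py; rewrite -dominated1; apply/subsetP/dominatedS.
Qed.

Lemma ext_private2r x y q :
  e x y -> q \in N[y] -> q \notin N[x] -> q \in ext_private e [set x; y] y.
Proof. by rewrite setUC sym_e; apply: ext_private2l. Qed.

Lemma card_dominated2 x y :
  #|dominated e [set x; y]| + #|N[x] :&: N[y]| = #|N[x]| + #|N[y]|.
Proof. by rewrite dominatedU !dominated1 cardsUI. Qed.

Definition path3_on v h w : Prop :=
  [/\ [set: V] = [set v; h; w], v != w, e v h, e h w & ~~ e v w].

Lemma path3_on_sym v h w : path3_on v h w -> path3_on w h v.
Proof.
case=> VE vw vh hw nvw; split; rewrite 1?eq_sym 1?sym_e //.
by rewrite VE setUC setUA setUAC.
Qed.

Lemma path3_on_cases v h w x : path3_on v h w -> [\/ x = v, x = h | x = w].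
Proof.
case=> VE _ _ _ _; have := in_setT x; rewrite VE !inE -orbA.
by case/or3P=> /eqP->; [apply: Or31 | apply: Or32 | apply: Or33].
Qed.

Lemma path3_on_card v h w : path3_on v h w -> #|V| = 3.
Proof.
case=> VE vw /edge_neq vh /edge_neq hw _.
rewrite -cardsT VE setUC cardsU1 in_set2 cards2 vh.
by rewrite eq_sym (negPf vw) eq_sym (negPf hw).
Qed.

Lemma path3_on_centre v h w : path3_on v h w -> N[h] = setT.
Proof.
move=> P; have [_ _ vh hw _] := P; apply/setP => x; rewrite !inE.
by case: (path3_on_cases x P) => ->; rewrite ?eqxx ?hw ?orbT // sym_e vh orbT.
Qed.

Lemma path3_on_end v h w x : path3_on v h w -> e x v -> x = h.
Proof.
move=> P; have [_ _ _ _ nvw] := P.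
by case: (path3_on_cases x P) => -> //; rewrite ?irr_e // sym_e (negPf nvw).
Qed.

Hypothesis con_e : connected_graph e.

Lemma connected_closed_setT (A : {set V}) x :
  x \in A -> {in A, forall y, N[y] \subset A} -> A = setT.
Proof.
move=> xA clA; apply/setP => y; rewrite inE.
rewrite -(closed_connect _ (con_e x y)) //.
apply: intro_closed; first exact: sym_connect_sym.
by move=> u v uv /clA/subsetP; apply; apply: edge_closed_nbhd.
Qed.

Lemma connected_neighbour x : 1 < #|V| -> exists y, e x y.
Proof.
move=> V2; apply/existsP; apply: contraTT V2 => /existsPn isol.
rewrite -leqNgt -cardsT -(@connected_closed_setT [set x] x) ?cards1 ?set11 //.
by move=> _ /set1P->; apply/subsetP => y; rewrite !inE (negPf (isol y)) orbF.
Qed.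

End SimpleGraph.

Section CompleteProduct.

Variables (m : nat) (V : finType) (e : rel V).

Local Notation N := (dominated e).
Local Notation prod := (cartesian_product (complete_graph m) e).

Implicit Types (A B E : {set V}) (D : {set 'I_m * V}) (i j : 'I_m) (v : V).

Definition row D i : {set V} := [set v | (i, v) \in D].

Lemma mem_dominated_prod D i v :
  ((i, v) \in dominated prod D) = (v \in snd @: D) || (v \in N (row D i)).
Proof.
apply/dominatedP/orP => [[[j u] juD]|[/imsetP[[j u] juD /= ->]|]].
- rewrite inE /cartesian_product xpair_eqE /=.
  case/or3P => [/andP[_ /eqP->]|/andP[/eqP ji uv]|/andP[/eqP <- _]].
  + by left; apply/imsetP; exists (j, u).
  + by right; apply/dominatedP; exists u; rewrite inE ?uv ?orbT // -ji.
  + by left; apply/imsetP; exists (j, u).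
- exists (j, u); rewrite // inE xpair_eqE eqxx andbT.
  rewrite /cartesian_product /complete_graph /= eqxx /= eq_sym.
  by case: eqP; rewrite ?orbT.
case/dominatedP => u uD uv; exists (i, u); first by rewrite inE in uD.
move: uv; rewrite !inE xpair_eqE /cartesian_product /= eqxx.
by case/orP=> ->; rewrite ?orbT.
Qed.

Lemma dominating_prodE D :
  dominating prod D <-> forall i, snd @: D :|: N (row D i) = setT.
Proof.
rewrite dominatingE; split=> [domD i|domD]; apply/setP.
  by move=> v; rewrite in_setU -mem_dominated_prod domD !in_setT.
by case=> i v; rewrite mem_dominated_prod -in_setU domD !inE.
Qed.

Section Layers.

Hypothesis m_gt1 : 1 < m.
Variable o : 'I_m.

Definition layers A B : {set 'I_m * V} := setX [set~ o] A :|: setX [set o] B.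

Lemma mem_layers A B i v :
  ((i, v) \in layers A B) = (v \in if i == o then B else A).
Proof. by rewrite !inE /=; case: eqVneq => //= _; rewrite orbF. Qed.

Lemma row_layers A B i : row (layers A B) i = if i == o then B else A.
Proof. by apply/setP => v; rewrite inE mem_layers. Qed.

Let other_row : exists i, i != o.
Proof. by apply: exists_neq; rewrite card_ord. Qed.

Lemma proj_layers A B : snd @: layers A B = A :|: B.
Proof.
have [i io] := other_row.
apply/setP => v; rewrite inE; apply/imsetP/orP => [[[j u] /setUP[]]|[vA|vB]].
- by case/setXP => _ uA /= ->; left.
- by case/setXP => _ uB /= ->; right.
- by exists (i, v); rewrite // mem_layers (negPf io).
- by exists (o, v); rewrite // mem_layers eqxx.
Qed.

Lemma card_layers A B : #|layers A B| = m.-1 * #|A| + #|B|.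
Proof.
rewrite cardsU !cardsX cards1 mul1n cardsC1 card_ord.
rewrite (_ : _ :&: _ = set0) ?cards0 ?subn0 //.
by apply/setP => -[i v]; rewrite !inE /=; case: (i == o) => //; rewrite andbF.
Qed.

Lemma layersS A B E : E \subset B -> layers A E \subset layers A B.
Proof. by move=> sEB; rewrite setUS ?setXS. Qed.

Lemma layers_dominatingE A B :
  dominating prod (layers A B) <-> B :|: N A = setT /\ A :|: N B = setT.
Proof.
have absorb (S T : {set V}) : S :|: T :|: N T = S :|: N T.
  by rewrite -setUA (setUidPr (sub_dominated e T)).
have [i io] := other_row.
rewrite dominating_prodE; split=> [dom|[domA domB] j].
  split; [have := dom i|have := dom o]; rewrite proj_layers row_layers.
    by rewrite (negPf io) [A :|: B]setUC absorb.
  by rewrite eqxx absorb.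
rewrite proj_layers row_layers; case: ifP => _; first by rewrite absorb.
by rewrite [A :|: B]setUC absorb.
Qed.

Lemma layersD1 A B b : layers A B :\ (o, b) = layers A (B :\ b).
Proof.
apply/setP => -[i v]; rewrite in_setD1 !mem_layers xpair_eqE.
by case: ifP; rewrite ?inE.
Qed.

Lemma layers_dominating_completion A :
  dominating prod (layers A (completion e A)).
Proof.
apply/layers_dominatingE.
by rewrite dominated_completion completionU_dominated setUT.
Qed.

Lemma layers_other_critical A B i a p :
    i != o -> p \notin A :|: B :|: N (A :\ a) ->
  ~ dominating prod (layers A B :\ (i, a)).
Proof.
move=> io; rewrite !in_setU => /norP[/norP[pA pB] pN].
move=> /dominating_prodE/(_ i)/setP/(_ p).
rewrite in_setT in_setU => /orP[/imsetP[[j u] + /= pu]|].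
  rewrite in_setD1 mem_layers -pu => /andP[_].
  by case: ifP => _; apply/negP.
apply/negP; apply: contra pN; apply/subsetP/dominatedS/subsetP => v.
by rewrite inE !in_setD1 mem_layers (negPf io) xpair_eqE eqxx.
Qed.

Lemma layers_base_critical A B b :
    b \notin N A \/ (exists p, p \notin A :|: N (B :\ b)) ->
  ~ dominating prod (layers A B :\ (o, b)).
Proof.
rewrite layersD1 => crit /layers_dominatingE[/setP/(_ b) + domB].
rewrite !inE eqxx /= => bN.
by case: crit => [|[p]]; rewrite ?bN ?domB ?inE.
Qed.

End Layers.

Section Necessity.

Hypotheses (m_gt1 : 1 < m) (sym_e : symmetric e) (irr_e : irreflexive e).
Hypothesis wd : well_dominated prod.

Local Notation "N[ v ]" := (closed_nbhd e v) (format "N[ v ]").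
Let o : 'I_m := Ordinal (ltnW m_gt1).

Let base_row : {set 'I_m * V} := layers o set0 setT.

Let card_base_row : #|base_row| = #|V|.
Proof. by rewrite card_layers cards0 muln0 cardsT. Qed.

Let base_row_dominating : dominating prod base_row.
Proof.
apply/layers_dominatingE => //; rewrite set0U setTU; split=> //.
by apply/eqP; rewrite -subTset sub_dominated.
Qed.

Lemma card_layers_dominating A B :
  dominating prod (layers o A B) -> #|V| <= m.-1 * #|A| + #|B|.
Proof.
move=> domAB; rewrite -card_base_row -(card_layers o).
apply: (well_dominated_card wd base_row_dominating domAB (subxx _)).
case=> i v; rewrite mem_layers; case: eqP => [-> _|_]; last by rewrite inE.
by apply: layers_base_critical => //; left; rewrite dominated0 inE.
Qed.

Lemma card_layers_critical A B E :
    dominating prod (layers o A B) -> E \subset B ->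
    {in A, forall a, exists p, p \notin A :|: B :|: N (A :\ a)} ->
    {in E, forall b, b \notin N A \/ exists p, p \notin A :|: N (B :\ b)} ->
  m.-1 * #|A| + #|E| <= #|V|.
Proof.
move=> domAB sEB critA critE; rewrite -card_base_row -(card_layers o).
apply: well_dominated_card wd domAB base_row_dominating (layersS _ _ sEB) _.
case=> i v; rewrite mem_layers; case: eqVneq => [-> vE|io vA].
  exact: layers_base_critical (critE v vE).
by have [p pN] := critA v vA; apply: layers_other_critical io pN.
Qed.

Lemma card_dominated_le A : #|N A| <= m * #|A|.
Proof.
have := card_layers_dominating (layers_dominating_completion m_gt1 o A).
rewrite card_completion -(cardsC (N A)) addnA leq_add2r -mulSnr prednK //.
exact: ltnW.
Qed.

Lemma card_dominated_ge A :
  {in A, forall a, ext_private e A a != set0} -> m.-1 * #|A| <= #|N A|.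
Proof.
move=> privA; rewrite -(leq_add2r #|~: N A|) cardsC.
apply: card_layers_critical (layers_dominating_completion m_gt1 o A) _ _ _.
- exact: subsetUr.
- move=> a /privA/set0Pn[p pA]; exists p.
  exact: ext_private_notin_completion.
- by move=> b; rewrite inE; left.
Qed.

Lemma card_dominated_ge_sub A :
    {in A, forall a, exists2 p, p \in ext_private e A a & N[p] \subset N A} ->
  m * #|A| <= #|N A|.
Proof.
move=> privA; rewrite -(leq_add2r #|~: N A|) cardsC -(prednK (ltnW m_gt1)).
rewrite mulSnr -addnA -card_completion.
apply: card_layers_critical (layers_dominating_completion m_gt1 o A) _ _ _.
- exact: subxx.
- move=> a /privA[p pA _]; exists p; exact: ext_private_notin_completion.
move=> b /setUP[/privA[p pA /subsetP spN]|]; last by rewrite inE; left.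
right; exists p; move: pA; rewrite in_setD !in_setU => /andP[/norP[pA pN] _].
rewrite (negPf pA) /=; apply: contra pN.
case/dominatedP => c /setD1P[cb /setUP[cA|cN]] pc.
  by apply/dominatedP; exists c => //; apply/setD1P.
by move: cN; rewrite inE spN // closed_nbhd_sym.
Qed.

Lemma card_closed_nbhd_le v : #|N[v]| <= m.
Proof.
by have := card_dominated_le [set v]; rewrite dominated1 cards1 muln1.
Qed.

Lemma edge_card_closed_nbhd_ge v u : e v u -> m.-1 <= #|N[v]|.
Proof.
move=> vu; rewrite -dominated1 -[m.-1]muln1 -(cards1 v).
apply: card_dominated_ge => _ /set1P->; apply/set0Pn; exists u.
exact: ext_private1.
Qed.

Lemma closed_nbhd_sub_card v h : e v h -> N[h] \subset N[v] -> #|N[v]| = m.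
Proof.
move=> vh shv; apply/eqP; rewrite eqn_leq card_closed_nbhd_le /=.
rewrite -dominated1 -[leqLHS]muln1 -(cards1 v).
apply: card_dominated_ge_sub => _ /set1P->.
by exists h; [apply: ext_private1 | rewrite dominated1].
Qed.

Lemma closed_nbhd_sub_exists v :
  #|N[v]| = m -> exists2 h, e v h & N[h] \subset N[v].
Proof.
move=> cv; apply/exists_inP; apply: contraT => /exists_inPn nsub.
suff: #|V| <= m.-1 * #|[set v]| + #|~: N[v]|.
  by rewrite cards1 -(cardsC N[v]) cv; lia.
apply/card_layers_dominating/layers_dominatingE => //.
rewrite dominated1 setUC setUCr; split=> //.
apply/setP => x; rewrite in_setT; apply/setUP.
have [->|xv] := eqVneq x v; first by left; rewrite set11.
right; have [vx|xNv] := boolP (e v x); last first.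
  by apply: (subsetP (sub_dominated e _)); rewrite !inE negb_or xv.
have /subsetPn[b bx bv] := nsub x vx.
by apply/dominatedP; exists b; rewrite ?in_setC // closed_nbhd_sym.
Qed.

Lemma incomparable_edge x y : e x y ->
    ~~ (N[x] \subset N[y]) -> ~~ (N[y] \subset N[x]) ->
  [/\ #|N[x]| = m, #|N[y]| = m & N[x] :&: N[y] = [set x; y]].
Proof.
move=> xy /subsetPn[p px py] /subsetPn[q qy qx].
have xy2 : #|[set x; y]| = 2 by rewrite cards2 (edge_neq irr_e xy).
have : m.-1 * #|[set x; y]| <= #|N [set x; y]|.
  apply: card_dominated_ge => z /set2P[]->; apply/set0Pn.
    by exists p; apply: ext_private2l.
  by exists q; apply: ext_private2r.
have sI := edge_sub_closed_nbhdI sym_e xy; have := subset_leq_card sI.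
have := card_dominated2 e x y.
have [] := (card_closed_nbhd_le x, card_closed_nbhd_le y).
rewrite xy2 => *; split; try lia.
by apply/eqP; rewrite eq_sym eqEcard sI xy2; lia.
Qed.

(* Otherwise N[x] and N[y] would have 2m elements in all, whereas each has at
   most m and they share x and y. *)
Lemma not_both_pendant x y p q : e x y ->
    p \in N[x] -> p \notin N[y] -> N[p] \subset N[x] ->
    q \in N[y] -> q \notin N[x] -> ~~ (N[q] \subset N[y]).
Proof.
move=> xy px py spx qy qx; apply/negP => sqy.
have : m * #|[set x; y]| <= #|N [set x; y]|.
  apply: card_dominated_ge_sub => z /set2P[]->; rewrite dominatedU !dominated1.
    by exists p; [apply: ext_private2l | rewrite subsetU ?spx].
  by exists q; [apply: ext_private2r | rewrite subsetU ?sqy ?orbT].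
have := subset_leq_card (edge_sub_closed_nbhdI sym_e xy).
have := card_dominated2 e x y.
have [] := (card_closed_nbhd_le x, card_closed_nbhd_le y).
by rewrite cards2 (edge_neq irr_e xy); lia.
Qed.

Lemma small_closed_nbhd_proper v h :
  #|N[v]| < m -> e v h -> N[v] \proper N[h] /\ #|N[h]| = m.
Proof.
move=> cv vh.
have nhv : ~~ (N[h] \subset N[v]).
  by apply/negP => /(closed_nbhd_sub_card vh) cvm; rewrite cvm ltnn in cv.
have pvh : N[v] \proper N[h].
  rewrite properE nhv andbT; apply: contraLR cv => nvh.
  by have [-> _ _] := incomparable_edge vh nvh nhv; rewrite ltnn.
split=> //; have := proper_card pvh; have := card_closed_nbhd_le h.
by have := edge_card_closed_nbhd_ge vh; lia.
Qed.

Lemma small_closed_nbhd_setU1 v h : #|N[v]| < m -> e v h ->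
  exists2 w, w \notin N[v] & N[h] = w |: N[v] /\ #|N[w]| < m.
Proof.
move=> cv vh.
have [/properP[svh [w wh wv]] ch] := small_closed_nbhd_proper cv vh.
have eh : N[h] = w |: N[v].
  apply/eqP; rewrite eq_sym eqEcard subUset sub1set wh svh cardsU1 wv ch.
  by have := edge_card_closed_nbhd_ge vh; lia.
exists w; rewrite // eh; split=> //; rewrite ltn_neqAle card_closed_nbhd_le.
rewrite andbT; apply/eqP => /closed_nbhd_sub_exists[x wx sxw].
have vx : v \notin N[x].
  by apply: contra wv => /(subsetP sxw); rewrite closed_nbhd_sym.
have hw : e h w.
  rewrite edgeE // wh andbT.
  by apply: contraNneq wv => <-; apply: edge_closed_nbhd.
have vNw : v \notin N[w] by rewrite closed_nbhd_sym.
have xNh : x \notin N[h].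
  by rewrite eh in_setU1 negb_or eq_sym (edge_neq irr_e wx) closed_nbhd_sym.
have vNh : v \in N[h] by rewrite closed_nbhd_sym // edge_closed_nbhd.
by case/negP: (not_both_pendant hw vNh vNw svh (edge_closed_nbhd wx) xNh).
Qed.

Lemma card_independent_pendants h (X : {set V}) :
    h \notin X -> {in X, forall x, N[x] \subset N[h]} ->
    {in X, forall x, x \notin N (X :\ x)} ->
    N[h] \subset h |: N X -> ~~ (N[h] \subset h |: X) ->
  m.-1 + #|X| <= #|N[h]|.
Proof.
move=> hX sXh indX domX /subsetPn[u uh uX].
have sX : X \subset N[h].
  by apply/subsetP => x /sXh/subsetP; apply; apply: closed_nbhd_refl.
rewrite -(leq_add2r #|~: N[h]|) cardsC -addnA -cardsUC // -[m.-1]muln1.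
rewrite -(cards1 h); apply: card_layers_critical (subxx _) _ _.
- apply/layers_dominatingE => //; rewrite dominated1 setUUC; split=> //.
  apply/eqP; rewrite -subTset -(setUCr N[h]) dominatedU setUA subUset.
  by rewrite (subsetU (C := N _)) ?domX // subsetU // sub_dominated orbT.
- move=> _ /set1P->; exists u; rewrite setDv dominated0 setU0 setUA.
  by rewrite in_setU in_setC uh orbF.
move=> x /setUP[xX|]; last by rewrite dominated1 inE; left.
right; exists x; rewrite in_setU negb_or; apply/andP; split.
  by apply: contraNN hX => /set1P<-.
apply: contra (indX x xX) => /dominatedP[c /setD1P[cx /setUP[cX|ch]] xc].
  by apply/dominatedP; exists c => //; apply/setD1P.
by move: ch; rewrite inE (subsetP (sXh x xX)) // closed_nbhd_sym.
Qed.

Lemma closed_nbhd_setU1_eq3 v h w :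
    e v h -> w \notin N[v] -> N[h] = w |: N[v] -> N[w] \subset N[h] ->
  N[h] = [set v; h; w].
Proof.
move=> vh wv eh swh; have hv := edge_neq irr_e vh.
have hw : h != w by apply: contraNneq wv => <-; apply: edge_closed_nbhd.
have vw : v != w by apply: contraNneq wv => <-; apply: closed_nbhd_refl.
have svh : N[v] \subset N[h] by rewrite eh subsetUr.
apply/eqP; rewrite eqEsubset andbC !subUset !sub1set closed_nbhd_refl.
rewrite closed_nbhd_sym // edge_closed_nbhd //= {1}eh setU11 /=.
apply: contraT => nsub; suff: m.-1 + #|[set v; w]| <= #|N[h]|.
  by have := card_closed_nbhd_le h; rewrite cards2 vw; lia.
apply: card_independent_pendants.
- by rewrite !inE negb_or eq_sym hv.
- by move=> _ /set2P[]->.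
- move=> _ /set2P[]->.
    have -> : [set v; w] :\ v = [set w] by rewrite setU1K ?inE.
    by rewrite dominated1 closed_nbhd_sym.
  have -> : [set v; w] :\ w = [set v] by rewrite setUC setU1K // inE eq_sym.
  by rewrite dominated1.
- rewrite dominatedU !dominated1 eh subUset sub1set !inE eqxx !orbT /=.
  by rewrite setUCA subsetUl.
by apply: contra nsub => /subset_trans->//; rewrite setUCA setUA.
Qed.

Hypothesis con_e : connected_graph e.

Lemma small_closed_nbhd_path3 v h : #|N[v]| < m -> e v h ->
  exists2 w, path3_on e v h w & m = 3.
Proof.
move=> cv vh; have [w wv [eh cw]] := small_closed_nbhd_setU1 cv vh.
have hw : e h w.
  rewrite edgeE // eh setU11 andbT.
  by apply: contraNneq wv => <-; apply: edge_closed_nbhd.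
have [svh ch] := small_closed_nbhd_proper cv vh.
have [swh _] := small_closed_nbhd_proper cw (etrans (sym_e w h) hw).
have eh3 := closed_nbhd_setU1_eq3 vh wv eh (proper_sub swh).
have hT : N[h] = setT.
  apply: (connected_closed_setT sym_e con_e (closed_nbhd_refl e h)) => y.
  rewrite {1}eh3 -setUA => /setUP[/set1P->|/set2P[]->] //; exact: proper_sub.
have P : path3_on e v h w.
  split; rewrite -?hT //; last by apply: contra wv; apply: edge_closed_nbhd.
  by apply: contraNneq wv => <-; apply: closed_nbhd_refl.
by exists w; rewrite // -ch hT cardsT (path3_on_card irr_e P).
Qed.

Lemma regular_closed_nbhd_setT v : (forall x, #|N[x]| = m) -> N[v] = setT.
Proof.
move=> reg; have sub_eq x y : N[x] \subset N[y] -> N[x] = N[y].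
  by move=> sxy; apply/eqP; rewrite eqEcard sxy !reg leqnn.
have [h vh /sub_eq ehv] := closed_nbhd_sub_exists (reg v).
apply: (connected_closed_setT sym_e con_e (closed_nbhd_refl e v)) => y vy.
apply: contraT => nyv; have nvy : ~~ (N[v] \subset N[y]).
  by apply: contra nyv => /sub_eq->.
have evy : e v y by rewrite edgeE // vy andbT; apply: contraNneq nyv => ->.
have [_ _ /setP/(_ h)] := incomparable_edge evy nvy nyv.
rewrite in_setI -ehv closed_nbhd_refl in_set2 eq_sym.
rewrite (negPf (edge_neq irr_e vh)).
rewrite closed_nbhd_sym // ehv vy /= => /esym/eqP hy.
by rewrite -hy ehv subxx in nyv.
Qed.

End Necessity.

Lemma has_dominating_subset_column D :
  snd @: D = setT -> has_dominating_subset prod D #|V|.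
Proof.
move=> projD; have /fin_all_exists[f fD] (v : V) : exists i, (i, v) \in D.
  by have := in_setT v; rewrite -projD => /imsetP[[i u] iuD ->]; exists i.
exists [set (f v, v) | v : V]; split.
- by apply/subsetP => _ /imsetP[v _ ->].
- apply/dominating_prodE => i; apply/eqP; rewrite -subTset subsetU //.
  apply/orP; left; apply/subsetP => v _; apply/imsetP.
  by exists (f v, v); rewrite ?imset_f.
- by rewrite card_imset // => x y [].
Qed.

Lemma has_dominating_subset_row D (g : 'I_m -> V) :
    (forall i, (i, g i) \in D) ->
    (forall i, [set g j | j : 'I_m] :|: closed_nbhd e (g i) = setT) ->
  has_dominating_subset prod D m.
Proof.
move=> gD domg; exists [set (i, g i) | i : 'I_m]; split.
- by apply/subsetP => _ /imsetP[i _ ->].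
- apply/dominating_prodE => i; rewrite -imset_comp -(domg i) -dominated1.
  congr (_ :|: dominated e _); apply/setP => v; rewrite !inE.
  by apply/imsetP/eqP => [[j _ [-> ->]]|->]; last exists i.
- by rewrite card_imset ?card_ord // => i j [].
Qed.

Lemma dominating_missed_column D v : dominating prod D -> v \notin snd @: D ->
  forall i, exists2 u, (i, u) \in D & e u v.
Proof.
move=> /dominating_prodE domD vD i; have /setP/(_ v) := domD i.
rewrite in_setT in_setU (negPf vD) => /dominatedP[u]; rewrite !inE => uD.
case/orP => [/eqP vu|]; last by exists u.
by case/imsetP: vD; exists (i, u).
Qed.

Lemma well_dominated_complete_prod :
  #|V| = m -> (forall v, closed_nbhd e v = setT) -> well_dominated prod.
Proof.
move=> cV nbhdT; apply: (@well_dominated_const _ _ m) => D domD.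
have [/has_dominating_subset_column|] := eqVneq (snd @: D) setT.
  by rewrite cV.
rewrite -subTset => /subsetPn[v _ /(dominating_missed_column domD) rowD].
have /fin_all_exists[g gD] i : exists u, (i, u) \in D.
  by have [u] := rowD i; exists u.
by apply: has_dominating_subset_row gD _ => i; rewrite nbhdT setUT.
Qed.

Section Path3.

Hypotheses (sym_e : symmetric e) (irr_e : irreflexive e).

Lemma has_dominating_subset_missed_end D v h w :
    path3_on e v h w -> dominating prod D -> v \notin snd @: D ->
  has_dominating_subset prod D m.
Proof.
move=> P domD vD; apply: (@has_dominating_subset_row D (fun=> h)) => i.
  have [u uD] := dominating_missed_column domD vD i.
  by move/(path3_on_end sym_e irr_e P) <-.
by rewrite (path3_on_centre sym_e P) setUT.
Qed.

Lemma has_dominating_subset_missed_centre D v h w :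
    1 < m -> path3_on e v h w -> dominating prod D ->
    v \in snd @: D -> h \notin snd @: D -> w \in snd @: D ->
  has_dominating_subset prod D m.
Proof.
move=> m_gt1 P domD vD hD wD; have [_ _ vh hw _] := P.
pose hit u := [set i | (i, u) \in D].
have hit0 u : u \in snd @: D -> hit u != set0.
  by case/imsetP=> -[i u'] iD ->; apply/set0Pn; exists i; rewrite inE.
have hitT : hit v :|: hit w = setT.
  apply/setP => i; rewrite !inE.
  have [u uD uh] := dominating_missed_column domD hD i.
  case: (path3_on_cases u P) uh uD => ->; rewrite ?irr_e // => _ -> //.
  exact: orbT.
have [] := cover_distinct_representatives _ hitT (hit0 v vD) (hit0 w wD).
  by rewrite card_ord.
move=> a; rewrite inE => aD [b]; rewrite inE => bD ab.
pose g i := if i == a then v else if (i, w) \in D then w else v.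
have ga : g a = v by rewrite /g eqxx.
have gb : g b = w by rewrite /g eq_sym (negPf ab) bD.
apply: (@has_dominating_subset_row D g) => i.
  have := in_setT i; rewrite -hitT !inE /g.
  by case: eqVneq => [->//|_]; case: ifP => // _; rewrite orbF.
have gi_h : h \in closed_nbhd e (g i).
  by rewrite inE /g; do 2?case: ifP => _; rewrite ?vh 1?sym_e ?hw orbT.
apply/setP => x; rewrite in_setU in_setT.
case: (path3_on_cases x P) => ->; rewrite ?gi_h ?orbT //.
  by rewrite -{1}ga imset_f.
by rewrite -{1}gb imset_f.
Qed.

Lemma well_dominated_path3_prod v h w :
  m = 3 -> path3_on e v h w -> well_dominated prod.
Proof.
move=> m3 P; apply: (@well_dominated_const _ _ m) => D domD.
have [vD|] := boolP (v \in snd @: D); last first.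
  exact: has_dominating_subset_missed_end P domD.
have [wD|] := boolP (w \in snd @: D); last first.
  exact: has_dominating_subset_missed_end (path3_on_sym sym_e P) domD.
have [hD|hD] := boolP (h \in snd @: D); last first.
  by apply: has_dominating_subset_missed_centre P domD vD hD wD; rewrite m3.
have: snd @: D = setT.
  apply/eqP; rewrite -subTset; apply/subsetP => x _.
  by case: (path3_on_cases x P) => ->.
by move/has_dominating_subset_column; rewrite (path3_on_card irr_e P) -m3.
Qed.

End Path3.

End CompleteProduct.

Lemma graph_iso_sym (V1 V2 : finType) (e1 : rel V1) (e2 : rel V2) :
  graph_iso e1 e2 -> graph_iso e2 e1.
Proof.
case=> f [[g fK gK] ef]; exists g; split; first by exists f.
by move=> x y; rewrite -ef !gK.
Qed.

Section Recognition.

Variables (V : finType) (e : rel V).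
Hypotheses (sym_e : symmetric e) (irr_e : irreflexive e).

Lemma graph_iso_complete m :
  graph_iso e (complete_graph m) <->
  #|V| = m /\ forall v, closed_nbhd e v = setT.
Proof.
split=> [[f [bij_f ef]]|[<- nbhdT]].
  split=> [|v]; first by rewrite (bij_eq_card bij_f) card_ord.
  apply/setP => u.
  by rewrite !inE -ef /complete_graph (bij_eq bij_f) eq_sym orbN.
exists enum_rank; split; first exact: enum_rank_bij.
move=> x y; rewrite (edgeE irr_e) nbhdT inE andbT /complete_graph.
by rewrite (inj_eq enum_rank_inj).
Qed.

Lemma graph_iso_path3 :
  graph_iso e path3 <-> exists v h w, path3_on e v h w.
Proof.
split=> [/graph_iso_sym[f [bij_f ef]]|[v [h [w P]]]].
  exists (f (@Ordinal 3 0 isT)), (f (@Ordinal 3 1 isT)), (f (@Ordinal 3 2 isT)).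
  split; rewrite ?ef ?(bij_eq bij_f) //.
  have [g _ gK] := bij_f; apply/setP => x; rewrite !inE -(gK x) !(bij_eq bij_f).
  by case: (g x) => -[|[|[|]]].
have [_ vw vh hw nvw] := P; have cV := path3_on_card irr_e P.
pose f (i : 'I_3) := nth v [:: v; h; w] i.
apply: graph_iso_sym; exists f; split.
  apply: inj_card_bij; last by rewrite cV card_ord.
  move=> i j /eqP; rewrite nth_uniq ?ltn_ord //; first by move/eqP/val_inj.
  by rewrite /= !inE negb_or vw (edge_neq irr_e vh) (edge_neq irr_e hw).
by case=> [[|[|[|//]]] ?] [[|[|[|//]]] ?]; rewrite /f /path3 /=;
  rewrite ?irr_e ?vh ?hw ?(negPf nvw) // sym_e ?vh ?hw ?(negPf nvw).
Qed.

End Recognition.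

Theorem theorem3 (m : nat) (V : finType) (e : rel V) :
  2 <= m -> simple_graph e -> connected_graph e -> 2 <= #|V| ->
  (well_dominated (cartesian_product (complete_graph m) e) <->
   ((m != 3) /\ graph_iso e (complete_graph m)) \/
   ((m = 3) /\ (graph_iso e (complete_graph 3) \/ graph_iso e path3))).
Proof.
move=> m_gt1 [sym_e irr_e] con_e V_gt1; split=> [wd|].
  have [/existsP[v cv]|/existsPn reg] :=
      boolP [exists v, #|closed_nbhd e v| < m].
    have [h vh] := connected_neighbour sym_e con_e v V_gt1.
    have [w P m3] := small_closed_nbhd_path3 m_gt1 sym_e irr_e wd con_e cv vh.
    by right; split=> //; right; apply/graph_iso_path3 => //; exists v, h, w.
  have {}reg v : #|closed_nbhd e v| = m.
    by apply/eqP; rewrite eqn_leq card_closed_nbhd_le // leqNgt reg.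
  have nbhdT v := regular_closed_nbhd_setT m_gt1 sym_e irr_e wd con_e v reg.
  have iso : graph_iso e (complete_graph m).
    apply/graph_iso_complete => //; split=> //.
    have /card_gt0P[v _] := ltnW V_gt1.
    by rewrite -(reg v) nbhdT cardsT.
  by have [m3|] := eqVneq m 3; [right; split=> //; left; rewrite -m3 | left].
case=> [[_ /(graph_iso_complete irr_e)[]]|[m3 []]].
- exact: well_dominated_complete_prod.
- rewrite -m3 => /(graph_iso_complete irr_e)[].
  exact: well_dominated_complete_prod.
case/(graph_iso_path3 sym_e irr_e) => v [h [w P]].
exact: well_dominated_path3_prod m3 P.
Qed.
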